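(* Let $(X,r)$ be a non-degenerate symmetric set (not necessarily finite) whose YB monoid $S(X,r)$ embeds in $G=G(X,r)$. The following are equivalent: (1) the associated left brace $(G,+,\cdot)$ is a two-sided brace; (2) the associated symmetric group $(G,r_G)$ is square-free (i.e. ${}^aa=a$ for all $a\in G$); (3) $(X,r)$ is square-free and ${}^{xy}(xy)=xy$ for all $x,y\in G$; (4) the group $G(X,r)$ is the free abelian group on $X$, so $(G,r_G)$ is the trivial solution; (5) $(X,r)$ is the trivial solution, i.e. $r(x,y)=(y,x)$ for all $x,y\in X$.
   Context: A symmetric set is a pair $(X,r)$, $X$ nonempty, $r(x,y)=({}^xy,x^y)$ a non-degenerate (all $y\mapsto{}^xy$, $y\mapsto y^x$ bijective), involutive bijection of $X\times X$ satisfying $r^{12}r^{23}r^{12}=r^{23}r^{12}r^{23}$ on $X^3$; square-free if $r(x,x)=(x,x)$ for all $x$. $S(X,r)$ (resp. $G(X,r)$) is the monoid (resp. group) generated by $X$ with relations $xy=zt$ whenever $r(x,y)=(z,t)\neq(x,y)$. A symmetric group is $(G,\sigma)$, $\sigma(u,v)=({}^uv,u^v)$ an involutive bijection of $G\times G$ with ${}^a1=1,{}^1u=u,1^u=1,a^1=a$, ${}^{ab}u={}^a({}^bu)$, $a^{uv}=(a^u)^v$, ${}^a(uv)=({}^au)({}^{a^u}v)$, $(ab)^u=(a^{{}^bu})(b^u)$, $uv=({}^uv)(u^v)$; $(G,r_G)$ is $G(X,r)$ with the unique such braiding restricting to $r$ on $X\times X$. Its left brace is $(G,+,\cdot)$ with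 $a+b:=a({}^{a^{-1}}b)$. A left brace $(B,+,\cdot)$ (abelian group $(B,+)$, group $(B,\cdot)$, $a(b+c)+a=ab+ac$) is two-sided if additionally $(a+b)c+c=ac+bc$ for all $a,b,c$. *)

(* Defs.v *)
Set Implicit Arguments.

Record monoid_on (M : Type) := MonoidOn {
  mmul : M -> M -> M;
  mone : M;
  mmulA : forall a b c, mmul a (mmul b c) = mmul (mmul a b) c;
  mmul1l : forall a, mmul mone a = a;
  mmul1r : forall a, mmul a mone = a
}.

Record group_on (G : Type) := GroupOn {
  gmul : G -> G -> G;
  gone : G;
  ginv : G -> G;
  gmulA : forall a b c, gmul a (gmul b c) = gmul (gmul a b) c;
  gmul1l : forall a, gmul gone a = a;
  gmul1r : forall a, gmul a gone = a;
  gmulVl : forall a, gmul (ginv a) a = gone;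
  gmulVr : forall a, gmul a (ginv a) = gone
}.

Definition abelian_group_on (G : Type) (g : group_on G) : Prop :=
  forall a b, gmul g a b = gmul g b a.

Definition is_group_hom (G H : Type) (g : group_on G) (h : group_on H)
  (phi : G -> H) : Prop :=
  forall a b, phi (gmul g a b) = gmul h (phi a) (phi b).

Definition is_monoid_hom_to_group (M G : Type) (m : monoid_on M) (g : group_on G)
  (phi : M -> G) : Prop :=
  phi (mone m) = gone g /\
  forall a b, phi (mmul m a b) = gmul g (phi a) (phi b).

Definition is_monoid_hom (M N : Type) (m : monoid_on M) (n : monoid_on N)
  (phi : M -> N) : Prop :=
  phi (mone m) = mone n /\
  forall a b, phi (mmul m a b) = mmul n (phi a) (phi b).

Definition fun_bijective (A B : Type) (f : A -> B) : Prop :=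
  exists g : B -> A, (forall a, g (f a) = a) /\ (forall b, f (g b) = b).

Definition injective_fun (A B : Type) (f : A -> B) : Prop :=
  forall a a', f a = f a' -> a = a'.

(* r (x, y) = ( ^x y , x^y ) *)
Definition lact (X : Type) (r : X * X -> X * X) (x y : X) : X := fst (r (x, y)).
Definition ract (X : Type) (r : X * X -> X * X) (x y : X) : X := snd (r (x, y)).

Definition r12 (X : Type) (r : X * X -> X * X) (t : X * X * X) : X * X * X :=
  let '(a, b, c) := t in let '(a', b') := r (a, b) in (a', b', c).
Definition r23 (X : Type) (r : X * X -> X * X) (t : X * X * X) : X * X * X :=
  let '(a, b, c) := t in let '(b', c') := r (b, c) in (a, b', c').

Definition nondegenerate (X : Type) (r : X * X -> X * X) : Prop :=
  forall x, fun_bijective (fun y => lact r x y) /\ fun_bijective (fun y => ract r y x).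

Definition involutive_map (X : Type) (r : X * X -> X * X) : Prop :=
  forall p, r (r p) = p.

Definition braided (X : Type) (r : X * X -> X * X) : Prop :=
  forall t, r12 r (r23 r (r12 r t)) = r23 r (r12 r (r23 r t)).

(* a symmetric set (involutivity makes r a bijection of X x X) *)
Definition symmetric_set (X : Type) (r : X * X -> X * X) : Prop :=
  inhabited X /\ nondegenerate r /\ involutive_map r /\ braided r.

Definition square_free_set (X : Type) (r : X * X -> X * X) : Prop :=
  forall x, r (x, x) = (x, x).

Definition trivial_solution (X : Type) (r : X * X -> X * X) : Prop :=
  forall x y, r (x, y) = (y, x).

(* defining relations xy = zt whenever r(x,y) = (z,t) (the case (z,t)=(x,y) is vacuous) *)
Definition respects_group (X H : Type) (r : X * X -> X * X) (h : group_on H)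
  (f : X -> H) : Prop :=
  forall x y, gmul h (f x) (f y) = gmul h (f (lact r x y)) (f (ract r x y)).

Definition respects_monoid (X N : Type) (r : X * X -> X * X) (n : monoid_on N)
  (f : X -> N) : Prop :=
  forall x y, mmul n (f x) (f y) = mmul n (f (lact r x y)) (f (ract r x y)).

Definition is_YB_group (X G : Type) (r : X * X -> X * X) (g : group_on G)
  (iota : X -> G) : Prop :=
  respects_group r g iota /\
  forall (H : Type) (h : group_on H) (f : X -> H), respects_group r h f ->
    (exists phi : G -> H, is_group_hom g h phi /\ forall x, phi (iota x) = f x) /\
    (forall phi psi : G -> H,
        is_group_hom g h phi -> (forall x, phi (iota x) = f x) ->
        is_group_hom g h psi -> (forall x, psi (iota x) = f x) ->
        forall a, phi a = psi a).

Definition is_YB_monoid (X M : Type) (r : X * X -> X * X) (m : monoid_on M)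
  (iotaS : X -> M) : Prop :=
  respects_monoid r m iotaS /\
  forall (N : Type) (n : monoid_on N) (f : X -> N), respects_monoid r n f ->
    (exists phi : M -> N, is_monoid_hom m n phi /\ forall x, phi (iotaS x) = f x) /\
    (forall phi psi : M -> N,
        is_monoid_hom m n phi -> (forall x, phi (iotaS x) = f x) ->
        is_monoid_hom m n psi -> (forall x, psi (iotaS x) = f x) ->
        forall a, phi a = psi a).

Definition is_free_abelian_on (X G : Type) (g : group_on G) (iota : X -> G) : Prop :=
  abelian_group_on g /\
  forall (H : Type) (h : group_on H) (f : X -> H), abelian_group_on h ->
    (exists phi : G -> H, is_group_hom g h phi /\ forall x, phi (iota x) = f x) /\
    (forall phi psi : G -> H,
        is_group_hom g h phi -> (forall x, phi (iota x) = f x) ->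
        is_group_hom g h psi -> (forall x, psi (iota x) = f x) ->
        forall a, phi a = psi a).

Definition lactG (G : Type) (s : G * G -> G * G) (a u : G) : G := fst (s (a, u)).
Definition ractG (G : Type) (s : G * G -> G * G) (a u : G) : G := snd (s (a, u)).

Definition symmetric_group (G : Type) (g : group_on G) (s : G * G -> G * G) : Prop :=
  let mul := gmul g in let one := gone g in
  let l := lactG s in let rr := ractG s in
  (forall p, s (s p) = p) /\
  (forall a, l a one = one) /\ (forall u, l one u = u) /\
  (forall u, rr one u = one) /\ (forall a, rr a one = a) /\
  (forall a b u, l (mul a b) u = l a (l b u)) /\
  (forall a u v, rr a (mul u v) = rr (rr a u) v) /\
  (forall a u v, l a (mul u v) = mul (l a u) (l (rr a u) v)) /\
  (forall a b u, rr (mul a b) u = mul (rr a (l b u)) (rr b u)) /\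
  (forall u v, mul u v = mul (l u v) (rr u v)).

Definition extends_r (X G : Type) (r : X * X -> X * X) (iota : X -> G)
  (s : G * G -> G * G) : Prop :=
  forall x y, s (iota x, iota y) = (iota (lact r x y), iota (ract r x y)).

Definition brace_add (G : Type) (g : group_on G) (s : G * G -> G * G) (a b : G) : G :=
  gmul g a (lactG s (ginv g a) b).

Definition two_sided (G : Type) (g : group_on G) (s : G * G -> G * G) : Prop :=
  forall a b c,
    brace_add g s (gmul g (brace_add g s a b) c) c
    = brace_add g s (gmul g a c) (gmul g b c).

(* Main.v *)
(* Every condition forces (X, r) to be trivial, and a trivial solution makes
   G(X,r) free abelian with the flip as braiding, which satisfies all of them.
   For (1) and (3) one evaluates the condition on elements of length at most two
   of G and compares words: since S(X,r) embeds in G, two words of length two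
   are equal in G only when they coincide or are exchanged by r.  Two-sidedness
   gives ^{x+x}z + z = ^x z + ^x z for generators x, z, and both sides of this
   are words of length two; for (3) one expands ^{xy}(xy) = xy. *)

Require Import Defs.
From Stdlib Require Import FunctionalExtensionality PropExtensionality ProofIrrelevance.
Set Implicit Arguments.

Lemma pair_eta (A B : Type) (p : A * B) : p = (fst p, snd p).
Proof. destruct p; reflexivity. Qed.

Section GroupFacts.
Variables (G : Type) (g : group_on G).
Local Infix "·" := (gmul g) (at level 40, left associativity).

Lemma gmul_cancel_l a b c : a · b = a · c -> b = c.
Proof.
  intro E. rewrite <- (gmul1l g b), <- (gmul1l g c), <- (gmulVl g a), <- !gmulA, E.
  reflexivity.
Qed.

Lemma gmul_cancel_r a b c : b · a = c · a -> b = c.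
Proof.
  intro E. rewrite <- (gmul1r g b), <- (gmul1r g c), <- (gmulVr g a), !gmulA, E.
  reflexivity.
Qed.

Lemma ginv_unique a u : a · u = gone g -> a = ginv g u.
Proof. intro E. apply (gmul_cancel_r u). rewrite E, gmulVl. reflexivity. Qed.

Lemma ginv_mul a b : ginv g (a · b) = ginv g b · ginv g a.
Proof.
  symmetry. apply ginv_unique.
  rewrite <- gmulA, (gmulA g (ginv g a)), gmulVl, gmul1l, gmulVl. reflexivity.
Qed.

Lemma ginv_ginv a : ginv g (ginv g a) = a.
Proof. symmetry. apply ginv_unique, gmulVr. Qed.

Lemma ginv_one : ginv g (gone g) = gone g.
Proof. symmetry. apply ginv_unique, gmul1l. Qed.

Lemma gcommute_inv a b : a · b = b · a -> ginv g a · b = b · ginv g a.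
Proof.
  intro E. apply (gmul_cancel_l a). rewrite !gmulA, gmulVr, gmul1l, E.
  rewrite <- gmulA, gmulVr, gmul1r. reflexivity.
Qed.

Lemma gcommute_mul a b c : a · c = c · a -> b · c = c · b -> a · b · c = c · (a · b).
Proof. intros Ea Eb. rewrite <- gmulA, Eb, gmulA, Ea, gmulA. reflexivity. Qed.

End GroupFacts.

Lemma sig_eq (A : Type) (P : A -> Prop) (u v : {a | P a}) :
  proj1_sig u = proj1_sig v -> u = v.
Proof. destruct u, v; simpl; intros ->; f_equal; apply proof_irrelevance. Qed.

Definition subgroup_on (G : Type) (g : group_on G) (P : G -> Prop) (P1 : P (gone g))
  (PM : forall a b, P a -> P b -> P (gmul g a b)) (PV : forall a, P a -> P (ginv g a)) :
  group_on {a | P a}.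
Proof.
  refine (@GroupOn {a | P a}
    (fun u v => exist P (gmul g (proj1_sig u) (proj1_sig v))
                        (PM _ _ (proj2_sig u) (proj2_sig v)))
    (exist P (gone g) P1)
    (fun u => exist P (ginv g (proj1_sig u)) (PV _ (proj2_sig u))) _ _ _ _ _);
  intros; apply sig_eq; simpl.
  - apply gmulA.
  - apply gmul1l.
  - apply gmul1r.
  - apply gmulVl.
  - apply gmulVr.
Defined.

Section YBGroupGeneration.
Variables (X G : Type) (r : X * X -> X * X) (g : group_on G) (iota : X -> G).
Hypothesis HYB : is_YB_group r g iota.
Local Infix "·" := (gmul g) (at level 40, left associativity).

(* The subgroup generated by iota X receives a map from G(X,r) by the universal
   property; by uniqueness, its composite with the inclusion is the identity. *)
Lemma YB_group_ind (P : G -> Prop) :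
  P (gone g) -> (forall a b, P a -> P b -> P (a · b)) -> (forall a, P a -> P (ginv g a)) ->
  (forall x, P (iota x)) -> forall a, P a.
Proof.
  destruct HYB as [Hresp HU]. intros P1 PM PV Px.
  set (h := subgroup_on g P P1 PM PV).
  set (f := fun x => exist P (iota x) (Px x)).
  assert (Hf : respects_group r h f) by (intros x y; apply sig_eq, Hresp).
  destruct (HU _ h f Hf) as [[phi [Hphi Hphix]] _].
  destruct (HU _ g iota Hresp) as [_ Huniq].
  assert (Eid : forall a, proj1_sig (phi a) = a).
  { apply (Huniq (fun a => proj1_sig (phi a)) (fun a => a)).
    - intros a b. rewrite Hphi. reflexivity.
    - intro x. rewrite Hphix. reflexivity.
    - intros a b. reflexivity.
    - reflexivity. }
  intro a. rewrite <- (Eid a). apply proj2_sig.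
Qed.

Lemma YB_group_abelian :
  (forall x y, iota x · iota y = iota y · iota x) -> abelian_group_on g.
Proof.
  intro Hxy.
  assert (Hcentral : forall x b, b · iota x = iota x · b).
  { intro x. apply YB_group_ind.
    - rewrite gmul1l, gmul1r. reflexivity.
    - intros a b Ha Hb. apply gcommute_mul; assumption.
    - intros a Ha. apply gcommute_inv, Ha.
    - intro y. apply Hxy. }
  intro a. pattern a. revert a. apply YB_group_ind.
  - intro b. rewrite gmul1l, gmul1r. reflexivity.
  - intros a b Ha Hb c. apply gcommute_mul; auto.
  - intros a Ha c. apply gcommute_inv, Ha.
  - intros x b. symmetry. apply Hcentral.
Qed.

End YBGroupGeneration.

Section SymmetricGroup.
Variables (G : Type) (g : group_on G) (s : G * G -> G * G).
Hypothesis Hs : symmetric_group g s.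
Local Infix "·" := (gmul g) (at level 40, left associativity).
Local Infix "⊕" := (brace_add g s) (at level 50, left associativity).
Local Notation lG := (lactG s).

Lemma sigma_involutive p : s (s p) = p.
Proof. now destruct Hs as (H & _). Qed.

Lemma lactG_one_r a : lG a (gone g) = gone g.
Proof. now destruct Hs as (_ & H & _). Qed.

Lemma lactG_one_l u : lG (gone g) u = u.
Proof. now destruct Hs as (_ & _ & H & _). Qed.

Lemma lactG_mul_l a b u : lG (a · b) u = lG a (lG b u).
Proof. now destruct Hs as (_ & _ & _ & _ & _ & H & _). Qed.

Lemma lactG_mul_r a u v : lG a (u · v) = lG a u · lG (ractG s a u) v.
Proof. now destruct Hs as (_ & _ & _ & _ & _ & _ & _ & H & _). Qed.

Lemma mul_lactG_ractG u v : u · v = lG u v · ractG s u v.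
Proof. now destruct Hs as (_ & _ & _ & _ & _ & _ & _ & _ & _ & H). Qed.

Lemma lactGK a b : lG (ginv g a) (lG a b) = b.
Proof. rewrite <- lactG_mul_l, gmulVl, lactG_one_l. reflexivity. Qed.

Lemma lactGVK a b : lG a (lG (ginv g a) b) = b.
Proof. rewrite <- lactG_mul_l, gmulVr, lactG_one_l. reflexivity. Qed.

Lemma lactG_inj a b c : lG a b = lG a c -> b = c.
Proof. intro E. rewrite <- (lactGK a b), E, lactGK. reflexivity. Qed.

Lemma lactG_lactG_ractG a v : lG (lG a v) (ractG s a v) = a.
Proof. unfold lactG, ractG. rewrite <- pair_eta, sigma_involutive. reflexivity. Qed.

Lemma mul_brace_add a b : a · b = a ⊕ lG a b.
Proof. unfold brace_add. rewrite lactGK. reflexivity. Qed.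

(* With b' = ^{a^-1} b, the braiding a b' = ^a b' a^{b'} = b a^{b'} exhibits a + b
   as b ^{b^-1} a. *)
Lemma brace_addC a b : a ⊕ b = b ⊕ a.
Proof.
  unfold brace_add. rewrite mul_lactG_ractG, lactGVK. f_equal.
  pose proof (lactG_lactG_ractG a (lG (ginv g a) b)) as E.
  rewrite lactGVK in E. apply (f_equal (lG (ginv g b))) in E. rewrite lactGK in E.
  exact E.
Qed.

Lemma lactG_brace_add a b c : lG a (b ⊕ c) = lG a b ⊕ lG a c.
Proof.
  unfold brace_add. rewrite lactG_mul_r. f_equal.
  rewrite <- (lactGVK b c) at 2.
  rewrite <- (lactG_mul_l a b), (mul_lactG_ractG a b), lactG_mul_l, lactGK. reflexivity.
Qed.

Lemma brace_addA a b c : a ⊕ b ⊕ c = a ⊕ (b ⊕ c).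
Proof.
  symmetry. unfold brace_add at 1. rewrite lactG_brace_add. unfold brace_add.
  rewrite ginv_mul, lactG_mul_l, gmulA. reflexivity.
Qed.

Lemma brace_add_cancel_l a b c : a ⊕ b = a ⊕ c -> b = c.
Proof. unfold brace_add. intro E. apply gmul_cancel_l, lactG_inj in E. exact E. Qed.

Lemma brace_addACA a b c d : a ⊕ b ⊕ (c ⊕ d) = a ⊕ c ⊕ (b ⊕ d).
Proof.
  rewrite !brace_addA. f_equal. rewrite <- !brace_addA. f_equal. apply brace_addC.
Qed.

(* Right distributivity at (a, b, c) = (x, x, z), after writing each product as a
   sum by mul_brace_add and cancelling x + x. *)
Lemma two_sided_lactG_double x z :
  two_sided g s -> lG (x ⊕ x) z ⊕ z = lG x z ⊕ lG x z.
Proof.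
  intro Hts. pose proof (Hts x x z) as E.
  rewrite (mul_brace_add (x ⊕ x) z), (mul_brace_add x z), brace_addA,
    (brace_addACA x (lG x z) x (lG x z)) in E.
  exact (brace_add_cancel_l _ _ _ E).
Qed.

End SymmetricGroup.

Section Solutions.
Variables (X : Type) (r : X * X -> X * X).

Lemma r_lact_ract x y : r (x, y) = (lact r x y, ract r x y).
Proof. apply pair_eta. Qed.

Lemma lact_inj : nondegenerate r -> forall x a b, lact r x a = lact r x b -> a = b.
Proof.
  intros Hnd x a b E. destruct (Hnd x) as [[h [Hh _]] _].
  rewrite <- (Hh a), <- (Hh b). simpl. rewrite E. reflexivity.
Qed.

Lemma lact_surj : nondegenerate r -> forall x b, exists a, lact r x a = b.
Proof. intros Hnd x b. destruct (Hnd x) as [[h [_ Hh]] _]. exists (h b). apply Hh. Qed.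

Lemma lact_lact_ract : involutive_map r -> forall x y, lact r (lact r x y) (ract r x y) = x.
Proof. intros Hinv x y. unfold lact at 1. rewrite <- r_lact_ract, Hinv. reflexivity. Qed.

Lemma trivial_of_lact_id :
  involutive_map r -> (forall x z, lact r x z = z) -> trivial_solution r.
Proof.
  intros Hinv Hid x y. rewrite r_lact_ract, Hid. f_equal.
  rewrite <- (lact_lact_ract Hinv x y) at 2. symmetry. apply Hid.
Qed.

Lemma square_free_of_lact_diag :
  nondegenerate r -> involutive_map r -> (forall x, lact r x x = x) -> square_free_set r.
Proof.
  intros Hnd Hinv Hdiag x. rewrite r_lact_ract, Hdiag. f_equal.
  apply (lact_inj Hnd x). rewrite Hdiag.
  rewrite <- (Hdiag x) at 1. apply lact_lact_ract, Hinv.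
Qed.

(* The quotient of S(X,r) by its words of length at least three (all collapsed
   to Deg2Big); a word xy is represented by its orbit {(x, y), r (x, y)}. *)
Inductive deg2 : Type :=
  | Deg2One
  | Deg2Gen (x : X)
  | Deg2Pair (orbit : X * X -> Prop)
  | Deg2Big.

Definition deg2_mul (a b : deg2) : deg2 :=
  match a, b with
  | Deg2One, b => b
  | a, Deg2One => a
  | Deg2Gen x, Deg2Gen y => Deg2Pair (fun p => p = (x, y) \/ p = r (x, y))
  | _, _ => Deg2Big
  end.

Definition deg2_monoid : monoid_on deg2.
Proof.
  refine (@MonoidOn deg2 deg2_mul Deg2One _ _ _).
  - intros [] [] []; reflexivity.
  - intros []; reflexivity.
  - intros []; reflexivity.
Defined.

Lemma deg2_respects : involutive_map r -> respects_monoid r deg2_monoid Deg2Gen.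
Proof.
  intros Hinv x y. simpl. f_equal.
  apply functional_extensionality; intro p. apply propositional_extensionality.
  unfold lact, ract. rewrite <- pair_eta, Hinv. tauto.
Qed.

End Solutions.

Section YBMonoidWords.
Variables (X M : Type) (r : X * X -> X * X) (m : monoid_on M) (iotaS : X -> M).
Hypotheses (Hinv : involutive_map r) (HYBm : is_YB_monoid r m iotaS).

Lemma YB_monoid_to_deg2 :
  exists phi : M -> deg2 X, is_monoid_hom m (deg2_monoid r) phi /\
                            forall x, phi (iotaS x) = Deg2Gen x.
Proof. destruct HYBm as [_ HU]. apply (HU _ _ _ (deg2_respects Hinv)). Qed.

Lemma YB_monoid_iota_inj x y : iotaS x = iotaS y -> x = y.
Proof.
  intro E. destruct YB_monoid_to_deg2 as [phi [_ Hphix]].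
  apply (f_equal phi) in E. rewrite !Hphix in E. injection E. trivial.
Qed.

Lemma YB_monoid_mul2_eq a b c d :
  mmul m (iotaS a) (iotaS b) = mmul m (iotaS c) (iotaS d) ->
  (a, b) = (c, d) \/ (a, b) = r (c, d).
Proof.
  intro E. destruct YB_monoid_to_deg2 as [phi [[_ Hphi] Hphix]].
  apply (f_equal phi) in E. rewrite !Hphi, !Hphix in E.
  injection E as E. apply (f_equal (fun orbit => orbit (a, b))) in E.
  rewrite <- E. left. reflexivity.
Qed.

End YBMonoidWords.

Definition monoid_of_group (H : Type) (h : group_on H) : monoid_on H :=
  @MonoidOn H (gmul h) (gone h) (gmulA h) (gmul1l h) (gmul1r h).

Section EmbeddedMonoid.
Variables (X G M : Type) (r : X * X -> X * X) (g : group_on G) (iota : X -> G)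
  (m : monoid_on M) (iotaS : X -> M).
Hypotheses (Hinv : involutive_map r) (HYB : is_YB_group r g iota)
  (HYBm : is_YB_monoid r m iotaS)
  (Hemb : forall phi : M -> G, is_monoid_hom_to_group m g phi ->
            (forall x, phi (iotaS x) = iota x) -> injective_fun phi).

Lemma YB_monoid_embedding :
  exists psi : M -> G, injective_fun psi /\
    (forall a b, psi (mmul m a b) = gmul g (psi a) (psi b)) /\
    forall x, psi (iotaS x) = iota x.
Proof.
  destruct HYB as [HrG _]. destruct HYBm as [_ HU].
  destruct (HU G (monoid_of_group g) iota HrG) as [[psi [[Hpsi1 Hpsi] Hpsix]] _].
  exists psi. split; [apply Hemb; [split|] |]; auto.
Qed.

Lemma YB_group_iota_inj x y : iota x = iota y -> x = y.
Proof.
  intro E. destruct YB_monoid_embedding as [psi [Hinj [_ Hpsix]]].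
  rewrite <- !Hpsix in E. exact (YB_monoid_iota_inj Hinv HYBm _ _ (Hinj _ _ E)).
Qed.

Lemma YB_group_mul2_eq a b c d :
  gmul g (iota a) (iota b) = gmul g (iota c) (iota d) ->
  (a, b) = (c, d) \/ (a, b) = r (c, d).
Proof.
  intro E. destruct YB_monoid_embedding as [psi [Hinj [Hpsi Hpsix]]].
  rewrite <- !Hpsix, <- !Hpsi in E. exact (YB_monoid_mul2_eq Hinv HYBm _ _ _ _ (Hinj _ _ E)).
Qed.

End EmbeddedMonoid.

Section Braiding.
Variables (X G : Type) (r : X * X -> X * X) (g : group_on G) (iota : X -> G)
  (sigma : G * G -> G * G).
Hypotheses (Hnd : nondegenerate r) (Hinv : involutive_map r)
  (HYB : is_YB_group r g iota) (Hs : symmetric_group g sigma)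
  (Hext : extends_r r iota sigma).
Hypotheses (iota_inj : forall x y, iota x = iota y -> x = y)
  (iota_mul2_eq : forall a b c d, gmul g (iota a) (iota b) = gmul g (iota c) (iota d) ->
                    (a, b) = (c, d) \/ (a, b) = r (c, d)).
Local Infix "·" := (gmul g) (at level 40, left associativity).
Local Infix "⊕" := (brace_add g sigma) (at level 50, left associativity).
Local Notation lG := (lactG sigma).

Lemma lactG_iota x y : lG (iota x) (iota y) = iota (lact r x y).
Proof. unfold lactG. rewrite Hext. reflexivity. Qed.

Lemma ractG_iota x y : ractG sigma (iota x) (iota y) = iota (ract r x y).
Proof. unfold ractG. rewrite Hext. reflexivity. Qed.

Lemma lactG_inv_iota x y : lG (ginv g (iota x)) (iota (lact r x y)) = iota y.
Proof. rewrite <- lactG_iota. apply (lactGK Hs). Qed.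

Lemma lactG_iota_closed a z : exists w, lG a (iota z) = iota w.
Proof.
  revert a z.
  enough (Hboth : forall a, (forall z, exists w, lG a (iota z) = iota w) /\
                            (forall z, exists w, lG (ginv g a) (iota z) = iota w))
    by (intros a' z'; apply Hboth).
  apply (YB_group_ind HYB).
  - rewrite ginv_one. split; intro z; exists z; apply (lactG_one_l Hs).
  - intros a b [Ha HaV] [Hb HbV]. split; intro z.
    + destruct (Hb z) as [w Hw], (Ha w) as [w' Hw'].
      exists w'. rewrite (lactG_mul_l Hs), Hw, Hw'. reflexivity.
    + destruct (HaV z) as [w Hw], (HbV w) as [w' Hw'].
      exists w'. rewrite ginv_mul, (lactG_mul_l Hs), Hw, Hw'. reflexivity.
  - intros a [Ha HaV]. rewrite ginv_ginv. split; assumption.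
  - intro x. split; intro z.
    + exists (lact r x z). apply lactG_iota.
    + destruct (lact_surj Hnd x z) as [w <-]. exists w. apply lactG_inv_iota.
Qed.

Lemma brace_add_iota p q : exists q', lact r p q' = q /\ iota p ⊕ iota q = iota p · iota q'.
Proof.
  destruct (lact_surj Hnd p q) as [q' <-]. exists q'. split; [reflexivity|].
  unfold brace_add. rewrite lactG_inv_iota. reflexivity.
Qed.

(* If ^x z = z' then ^{x+x}z + z = z' + z' is an equality of two words of length
   two, which forces z' = z. *)
Lemma two_sided_trivial : two_sided g sigma -> trivial_solution r.
Proof.
  intro Hts. apply (trivial_of_lact_id Hinv). intros x z.
  pose proof (two_sided_lactG_double Hs (iota x) (iota z) Hts) as E.
  destruct (lactG_iota_closed (iota x ⊕ iota x) z) as [w Hw].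
  rewrite Hw, lactG_iota in E. set (v := lact r x z) in E |- *.
  destruct (brace_add_iota w z) as [a [Ha Ea]], (brace_add_iota v v) as [b [Hb Eb]].
  rewrite Ea, Eb in E. destruct (iota_mul2_eq _ _ _ _ E) as [Ewa | Ewa].
  - injection Ewa as -> ->. rewrite <- Ha, Hb. reflexivity.
  - rewrite r_lact_ract, Hb in Ewa. injection Ewa as -> ->.
    rewrite <- Ha, <- (lact_lact_ract Hinv v b) at 1. rewrite Hb. reflexivity.
Qed.

Lemma lactG_diag_square_free : (forall a, lG a a = a) -> square_free_set r.
Proof.
  intro Hdiag. apply (square_free_of_lact_diag Hnd Hinv). intro x.
  apply iota_inj. rewrite <- lactG_iota. apply Hdiag.
Qed.

(* ^{xy}(xy) expands to the word ^x(^y x) . ^{x^{^y x}}(^{y^x} y); comparing it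
   with x y gives ^x(^y x) = x in both cases allowed by iota_mul2_eq. *)
Lemma square_free_trivial :
  square_free_set r -> (forall a b, lG (a · b) (a · b) = a · b) -> trivial_solution r.
Proof.
  intros Hsq Hdiag2.
  assert (Hdiag : forall x, lact r x x = x) by (intro x; unfold lact; rewrite Hsq; reflexivity).
  apply (trivial_of_lact_id Hinv). intros y x. apply (lact_inj Hnd x). rewrite Hdiag.
  pose proof (Hdiag2 (iota x) (iota y)) as E.
  rewrite (lactG_mul_l Hs), (lactG_mul_r Hs), lactG_iota, ractG_iota,
    (lactG_mul_r Hs), lactG_iota, ractG_iota, !lactG_iota in E.
  destruct (iota_mul2_eq _ _ _ _ E) as [Exy | Exy].
  - injection Exy as Ex _. exact Ex.
  - rewrite r_lact_ract in Exy. injection Exy as Ex _.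
    assert (Eyx : lact r y x = lact r y y) by (rewrite (lact_inj Hnd _ _ _ Ex), Hdiag; reflexivity).
    apply (lact_inj Hnd) in Eyx. subst x. rewrite Ex. apply Hdiag.
Qed.

Lemma lactG_trivial_all :
  (forall x y, lG (iota x) (iota y) = iota y) -> forall a v, lG a v = v.
Proof.
  intro Hxy.
  assert (Hgen : forall y a, lG a (iota y) = iota y).
  { intro y. apply (YB_group_ind HYB).
    - apply (lactG_one_l Hs).
    - intros a b Ha Hb. rewrite (lactG_mul_l Hs), Hb, Ha. reflexivity.
    - intros a Ha. rewrite <- Ha at 1. apply (lactGK Hs).
    - intro x. apply Hxy. }
  intros a v. revert a. pattern v. revert v. apply (YB_group_ind HYB).
  - apply (lactG_one_r Hs).
  - intros u w Hu Hw a. rewrite (lactG_mul_r Hs), Hu, Hw. reflexivity.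
  - intros u Hu a. apply ginv_unique.
    rewrite <- (lactG_one_r Hs a), <- (gmulVl g u), (lactG_mul_r Hs), Hu. reflexivity.
  - intros y a. apply Hgen.
Qed.

Section Trivial.
Hypothesis Htriv : trivial_solution r.

Lemma trivial_lact x y : lact r x y = y.
Proof. unfold lact. rewrite Htriv. reflexivity. Qed.

Lemma trivial_ract x y : ract r x y = x.
Proof. unfold ract. rewrite Htriv. reflexivity. Qed.

Lemma trivial_abelian : abelian_group_on g.
Proof.
  apply (YB_group_abelian HYB). intros x y.
  destruct HYB as [HrG _]. rewrite (HrG x y), trivial_lact, trivial_ract. reflexivity.
Qed.

Lemma trivial_free_abelian : is_free_abelian_on g iota.
Proof.
  split; [exact trivial_abelian|]. intros H h f Hh.
  destruct HYB as [_ HU]. apply HU. intros x y.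
  rewrite trivial_lact, trivial_ract. apply Hh.
Qed.

Lemma trivial_sigma_flip u v : sigma (u, v) = (v, u).
Proof.
  assert (Hid : forall a w, lG a w = w).
  { apply lactG_trivial_all. intros x y. rewrite lactG_iota, trivial_lact. reflexivity. }
  rewrite (pair_eta (sigma (u, v))). fold (lactG sigma u v) (ractG sigma u v).
  rewrite Hid. f_equal. apply (gmul_cancel_l g v).
  rewrite <- (Hid u v) at 1. rewrite <- (mul_lactG_ractG Hs). apply trivial_abelian.
Qed.

End Trivial.

Lemma flip_trivial : (forall u v, sigma (u, v) = (v, u)) -> trivial_solution r.
Proof.
  intro Hflip. apply (trivial_of_lact_id Hinv). intros x z. apply iota_inj.
  rewrite <- lactG_iota. unfold lactG. rewrite Hflip. reflexivity.
Qed.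

Lemma flip_two_sided :
  abelian_group_on g -> (forall u v, sigma (u, v) = (v, u)) -> two_sided g sigma.
Proof.
  intros Hab Hflip a b c. unfold brace_add, lactG. rewrite !Hflip. simpl.
  rewrite <- !gmulA. f_equal. rewrite (gmulA g c b c), <- (Hab b c), <- gmulA. reflexivity.
Qed.

End Braiding.

Theorem mainTheorem11
  (X : Type) (r : X * X -> X * X)
  (G : Type) (g : group_on G) (iota : X -> G)
  (M : Type) (m : monoid_on M) (iotaS : X -> M)
  (sigma : G * G -> G * G) :
  symmetric_set r ->
  is_YB_group r g iota ->
  is_YB_monoid r m iotaS ->
  (* S(X,r) embeds in G(X,r): the canonical monoid map S -> G is injective *)
  (forall phi : M -> G, is_monoid_hom_to_group m g phi ->
     (forall x, phi (iotaS x) = iota x) -> injective_fun phi) ->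
  (* sigma is the braiding r_G of G(X,r) extending r *)
  symmetric_group g sigma ->
  extends_r r iota sigma ->
  let P1 := two_sided g sigma in
  let P2 := forall a : G, lactG sigma a a = a in
  let P3 := square_free_set r /\
            forall x y : G, lactG sigma (gmul g x y) (gmul g x y) = gmul g x y in
  let P4 := is_free_abelian_on g iota /\ (forall u v : G, sigma (u, v) = (v, u)) in
  let P5 := trivial_solution r in
  (P1 <-> P2) /\ (P2 <-> P3) /\ (P3 <-> P4) /\ (P4 <-> P5).
Proof.
  intros [_ [Hnd [Hinv _]]] HYB HYBm Hemb Hs Hext. cbv zeta.
  pose proof (YB_group_iota_inj Hinv HYB HYBm Hemb) as iota_inj.
  pose proof (YB_group_mul2_eq Hinv HYB HYBm Hemb) as iota_mul2_eq.
  set (Flip := forall u v : G, sigma (u, v) = (v, u)).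
  set (Diag := forall a : G, lactG sigma a a = a).
  set (Diag2 := forall a b : G, lactG sigma (gmul g a b) (gmul g a b) = gmul g a b).
  assert (H15 : two_sided g sigma -> trivial_solution r)
    by exact (two_sided_trivial Hnd Hinv HYB Hs Hext iota_mul2_eq).
  assert (H23 : Diag -> square_free_set r /\ Diag2)
    by (intro Hdiag; split; [exact (lactG_diag_square_free Hnd Hinv Hext iota_inj Hdiag)
                            | intros a b; apply Hdiag]).
  assert (H35 : square_free_set r /\ Diag2 -> trivial_solution r)
    by (intros [Hsq Hdiag2]; exact (square_free_trivial Hnd Hinv Hs Hext iota_mul2_eq Hsq Hdiag2)).
  assert (H54 : trivial_solution r -> is_free_abelian_on g iota /\ Flip)
    by (intro Ht; split; [exact (trivial_free_abelian HYB Ht)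
                         | exact (trivial_sigma_flip HYB Hs Hext Ht)]).
  assert (H45 : Flip -> trivial_solution r) by exact (flip_trivial Hinv Hext iota_inj).
  assert (H41 : is_free_abelian_on g iota -> Flip -> two_sided g sigma)
    by (intros [Hab _]; exact (flip_two_sided sigma Hab)).
  assert (H42 : Flip -> Diag) by (intros Hflip a; unfold lactG; rewrite Hflip; reflexivity).
  clearbody Flip Diag Diag2. tauto.
Qed.
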